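(* Let $A$ and $B$ be two nonzero $0,1$-matrices. Then $\mathrm{R}_{\mathbb{B}}(A\otimes B)\ge \mu(A)\cdot\mathrm{R}_{\mathbb{B}}(B)$.
   Context: The Boolean rank $\mathrm{R}_{\mathbb{B}}(A)$ of a $0,1$-matrix $A$ is the smallest number of all-ones combinatorial rectangles needed to cover all $1$-entries of $A$; a combinatorial rectangle is a set $X\times Y$ with $X$ a set of row indices and $Y$ a set of column indices, and it is monochromatic (all-ones) if all entries of $A$ in it equal $1$. For a nonzero $0,1$-matrix $A$, $\mu(A)$ is the number of $1$-entries of $A$ divided by the largest number of $1$-entries in a monochromatic all-ones combinatorial rectangle of $A$. The Kronecker product $A\otimes B$ is the block matrix whose $(i,j)$-th block is $A_{i,j}\cdot B$. *)

(* Defs.v *)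
From mathcomp Require Import all_boot all_order all_algebra.
From mathcomp Require Export mxtens.

Set Implicit Arguments.
Unset Strict Implicit.
Unset Printing Implicit Defensive.

Import Order.TTheory GRing.Theory Num.Theory.
Local Open Scope ring_scope.

Section Matrix01.

Variables m n : nat.
Implicit Types (A : 'M[int]_(m, n)) (C : {set 'I_m * 'I_n}).
Implicit Type S : {set {set 'I_m * 'I_n}}.

Definition zero_one_mx A := forall i j, A i j = 0 \/ A i j = 1.

Definition ones A := [set ij | A ij.1 ij.2 == 1].

Definition rectangle C :=
  [exists X : {set 'I_m}, exists Y : {set 'I_n}, C == setX X Y].

Definition ones_rectangle A C := rectangle C && (C \subset ones A).

Definition ones_rectangle_cover A S :=
  [forall C in S, ones_rectangle A C] && (ones A \subset cover S).

Lemma ex_ones_rectangle_cover A :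
  exists k, [exists S, ones_rectangle_cover A S && (#|S| == k)].
Proof.
exists #|[set [set ij] | ij in ones A]|; apply/existsP.
exists [set [set ij] | ij in ones A]; rewrite eqxx andbT; apply/andP; split.
  apply/forall_inP=> _ /imsetP[[i j] Aij ->]; rewrite /ones_rectangle sub1set Aij.
  rewrite andbT; apply/existsP; exists [set i]; apply/existsP; exists [set j].
  by apply/eqP/setP=> -[i' j']; rewrite in_setX !inE xpair_eqE.
apply/subsetP=> ij Aij; apply/bigcupP; exists [set ij]; last exact: set11.
exact: imset_f.
Qed.

Definition boolean_rank A : nat := ex_minn (ex_ones_rectangle_cover A).

(* An all-ones rectangle C contains exactly #|C| 1-entries. The maximum is
   positive when A has a 1-entry; otherwise the value is 0 / 0 = 0. *)
Definition mu A : rat :=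
  #|ones A|%:R / (\max_(C | ones_rectangle A C) #|C|)%:R.

End Matrix01.

(* Main.v *)
Require Import Defs.
From mathcomp Require Import all_boot all_order all_algebra.
From mathcomp Require Import mxtens.

Set Implicit Arguments.
Unset Strict Implicit.
Unset Printing Implicit Defensive.

Import Order.TTheory GRing.Theory Num.Theory.
Local Open Scope ring_scope.

(** Fix an optimal cover S of the ones of A *t B. For every 1-entry (i, j) of
    A, the block (i, j) of A *t B is a copy of B, so the members of S that meet
    this block restrict to a cover of B: there are at least R_B(B) of them.
    Conversely the blocks met by one member of S form an all-ones rectangle of
    A. Double counting the pairs (block of a 1-entry, member of S meeting it)
    gives R_B(B) * #|ones A| <= #|S| * (size of the largest rectangle of A). *)

Lemma rectangleP (m n : nat) (C : {set 'I_m * 'I_n}) :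
  reflect (exists X Y, C = setX X Y) (rectangle C).
Proof.
apply: (iffP existsP) => [[X /existsP[Y /eqP->]]|[X [Y ->]]]; exists X.
  by exists Y.
by apply/existsP; exists Y.
Qed.

Lemma boolean_rank_min (m n : nat) (A : 'M[int]_(m, n)) S :
  ones_rectangle_cover A S -> (boolean_rank A <= #|S|)%N.
Proof.
rewrite /boolean_rank => covS; case: ex_minnP => k _; apply.
by apply/existsP; exists S; rewrite covS eqxx.
Qed.

Lemma boolean_rank_attained (m n : nat) (A : 'M[int]_(m, n)) :
  exists2 S, ones_rectangle_cover A S & #|S| = boolean_rank A.
Proof.
rewrite /boolean_rank; case: ex_minnP => k /existsP[S /andP[covS /eqP cardS]] _.
by exists S.
Qed.

Section Blocks.

Variables m n p q : nat.
Implicit Types (A : 'M[int]_(m, n)) (B : 'M[int]_(p, q)).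
Implicit Types C : {set 'I_(m * p) * 'I_(n * q)}.

(** The blocks of [A *t B] that [C] meets: [mxtens_unindex] splits an index into the block and the
    position inside it. *)
Definition tens_block C : {set 'I_m * 'I_n} :=
  [set ((mxtens_unindex xy.1).1, (mxtens_unindex xy.2).1) | xy in C].

Definition tens_slice C (ij : 'I_m * 'I_n) : {set 'I_p * 'I_q} :=
  [set kl | (mxtens_index (ij.1, kl.1), mxtens_index (ij.2, kl.2)) \in C].

(** A product of integers is 1 only as 1 * 1 or (-1) * (-1), and 0-1 entries exclude the latter. *)
Lemma in_ones_tens A B i j k l : zero_one_mx A -> zero_one_mx B ->
  ((mxtens_index (i, k), mxtens_index (j, l)) \in ones (A *t B)) =
  ((i, j) \in ones A) && ((k, l) \in ones B).
Proof.
move=> A01 B01; rewrite !inE /= tensmxE.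
by case: (A01 i j) => ->; case: (B01 k l) => ->.
Qed.

Lemma tens_slice_meets_block C ij kl :
  kl \in tens_slice C ij -> ij \in tens_block C.
Proof.
rewrite inE => Cij; apply/imsetP.
exists (mxtens_index (ij.1, kl.1), mxtens_index (ij.2, kl.2)) => //.
by rewrite !mxtens_indexK -surjective_pairing.
Qed.

(** Row and column indices project to block indices independently, so the image of [setX X Y] is
    again a product; by [in_ones_tens], a 1-entry of [A *t B] lies in the block of a 1-entry of
    [A]. *)
Lemma tens_block_ones_rectangle A B C : zero_one_mx A -> zero_one_mx B ->
  ones_rectangle (A *t B) C -> ones_rectangle A (tens_block C).
Proof.
move=> A01 B01 /andP[/rectangleP[X [Y ->]] /subsetP onesC]; apply/andP; split.
  apply/rectangleP; exists [set (mxtens_unindex x).1 | x in X].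
  exists [set (mxtens_unindex y).1 | y in Y]; apply/setP => -[i j].
  rewrite in_setX; apply/imsetP/andP => [[[x y]]|[/imsetP[x Xx ->]]].
    by rewrite in_setX => /andP[Xx Yy] [-> ->]; split; apply: imset_f.
  by case/imsetP=> y Yy ->; exists (x, y); rewrite ?in_setX ?Xx.
apply/subsetP => _ /imsetP[[x y] /onesC + ->].
case: (mxtens_indexP x) => i k; case: (mxtens_indexP y) => j l.
by rewrite !mxtens_indexK in_ones_tens // => /andP[].
Qed.

Lemma tens_slice_ones_rectangle A B C ij : zero_one_mx A -> zero_one_mx B ->
  ones_rectangle (A *t B) C -> ones_rectangle B (tens_slice C ij).
Proof.
move=> A01 B01 /andP[/rectangleP[X [Y ->]] /subsetP onesC]; apply/andP; split.
  apply/rectangleP; exists [set k | mxtens_index (ij.1, k) \in X].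
  exists [set l | mxtens_index (ij.2, l) \in Y].
  by apply/setP => -[k l]; rewrite in_setX !inE.
apply/subsetP => -[k l]; rewrite inE => /onesC.
by rewrite in_ones_tens // => /andP[].
Qed.

Lemma boolean_rank_le_meets A B S ij : zero_one_mx A -> zero_one_mx B ->
  ones_rectangle_cover (A *t B) S -> ij \in ones A ->
  (boolean_rank B <= #|[set C in S | ij \in tens_block C]|)%N.
Proof.
move=> A01 B01 /andP[/forall_inP rectS /subsetP coverS] Aij.
pose T := [set C in S | ij \in tens_block C].
(* Members of [T] with equal slices merge in the image, so the cover of [B] by slices has at most
   [#|T|] members. *)
apply: leq_trans (leq_imset_card (tens_slice^~ ij) T).
apply: boolean_rank_min; apply/andP; split.
  apply/forall_inP => _ /imsetP[C + ->]; rewrite inE => /andP[SC _].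
  exact: tens_slice_ones_rectangle (rectS C SC).
apply/subsetP => -[k l] Bkl.
have /coverS/bigcupP[C SC Ckl] :
    (mxtens_index (ij.1, k), mxtens_index (ij.2, l)) \in ones (A *t B).
  by rewrite in_ones_tens // Bkl andbT -surjective_pairing.
have slice_kl : (k, l) \in tens_slice C ij by rewrite inE.
apply/bigcupP; exists (tens_slice C ij) => //; apply: imset_f.
by rewrite inE SC (tens_slice_meets_block slice_kl).
Qed.

Lemma ones_mul_boolean_rank_le A B : zero_one_mx A -> zero_one_mx B ->
  (#|ones A| * boolean_rank B <=
   boolean_rank (A *t B) * \max_(C | ones_rectangle A C) #|C|)%N.
Proof.
move=> A01 B01; have [S covS <-] := boolean_rank_attained (A *t B).
rewrite -!sum_nat_const.
apply: (@leq_trans (\sum_(ij in ones A) \sum_(C in S | ij \in tens_block C) 1)).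
  apply: leq_sum => ij Aij; rewrite sum1dep_card.
  exact: boolean_rank_le_meets covS Aij.
rewrite (exchange_big_dep (mem S)) /=; last by move=> ? ? _ /andP[].
have /andP[/forall_inP rectS _] := covS.
apply: leq_sum => C SC.
have rectC := tens_block_ones_rectangle A01 B01 (rectS C SC).
(* [tens_block C] competes in the maximum, and the 1-entries of [A] counted for [C] all lie in
   it. *)
apply: leq_trans (leq_bigmax_cond _ rectC).
rewrite sum1dep_card subset_leq_card //; apply/subsetP => ij.
by rewrite inE => /and3P[].
Qed.

End Blocks.

Theorem theorem3 (m n p q : nat) (A : 'M[int]_(m, n)) (B : 'M[int]_(p, q))
  (hA01 : zero_one_mx A) (hB01 : zero_one_mx B) (hA : A != 0) (hB : B != 0) :
  (boolean_rank (A *t B))%:R >= mu A * (boolean_rank B)%:R.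
Proof.
have := ones_mul_boolean_rank_le hA01 hB01; rewrite /mu.
(* A zero maximum makes [mu A] zero, because the inverse of 0 is 0; a positive one can be cleared
   from the denominator. *)
case: (\max_(C | _) _)%N => [|M] le_ones; first by rewrite invr0 mulr0 mul0r.
by rewrite mulrAC ler_pdivrMr ?ltr0Sn // -!natrM ler_nat.
Qed.
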